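(* Let $\{\mathcal X_k\}_{k\in\mathbb N}$ (with $\mathcal X_0=\mathcal X$) and $\{\mathcal Y_k\}_{k\in\mathbb N}$ be the sequences defined in the context, and let $\mathcal M$ be the maximal robust positively invariant set. Then: (i) the sequence $\{\mathcal X_k\}$ is decreasing and contains $\mathcal M$, namely $\mathcal M\subseteq\mathcal X_{k+1}\subseteq\mathcal X_k$ for all $k\in\mathbb N$; (ii) $\mathcal M=\mathcal X_\infty:=\bigcap_{k\in\mathbb N}\mathcal X_k$; (iii) if $\mathcal X$ is closed, then $\mathcal X_k$ and $\mathcal Y_k$ are closed for every $k\in\mathbb N$; (iv) if $\mathcal X$ is convex, then $\mathcal X_k$ and $\mathcal Y_k$ are convex for every $k\in\mathbb N$; (v) if $\mathcal X=-\mathcal X$ and $\mathcal W=-\mathcal W$, then $\mathcal X_k=-\mathcal X_k$ and $\mathcal Y_k=-\mathcal Y_k$ for every $k\in\mathbb N$.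
   Context: $\mathbb N$ denotes the nonnegative integers. Let $\mathscr A\subseteq\mathbb R^{n\times n}$ be a nonempty family of matrices, $\mathcal W\subseteq\mathbb R^n$ a nonempty set, $\mathcal X\subseteq\mathbb R^n$ a set, and $\mathcal F(x):=\{Ax+w: A\in\mathscr A,\ w\in\mathcal W\}$. A set $\mathcal S\subseteq\mathbb R^n$ is robust positively invariant if for all $x\in\mathcal S$ one has $\mathcal F(x)\subseteq\mathcal S$ and $x\in\mathcal X$; the maximal robust positively invariant set $\mathcal M$ is the (existing, unique) robust positively invariant set containing every other one. Set $\mathcal Y_0:=\mathcal X$, and for $k\ge1$ let $\mathcal Y_k$ be the set of $x_0\in\mathbb R^n$ such that $x_k\in\mathcal X$ for all $A_0,\dots,A_{k-1}\in\mathscr A$ and all $w_0,\dots,w_{k-1}\in\mathcal W$, where $x_{j+1}=A_jx_j+w_j$ for $j=0,\dots,k-1$. The sequence $\{\mathcal X_k\}$ is given by $\mathcal X_0:=\mathcal X$ and any one of the following recursions (which generate the same sequence), where $\overline{\mathcal X}_{k+1}:=\{x\in\mathbb R^n:\ Ax+w\in\mathcal X_k\ \forall A\in\mathscr A,\ w\in\mathcal W\}$: standard, $\mathcal X_{k+1}=\overline{\mathcal X}_{k+1}\cap\mathcal X$; self-restricted, $\mathcal X_{k+1}=\overline{\mathcal X}_{k+1}\cap\mathcal X_k$; incremental, $\mathcal X_{k+1}=\mathcal X_k\cap\mathcal Y_{k+1}$. For a set $\mathcal S$, $-\mathcal S:=\{-x:x\in\mathcal S\}$. *)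

(* Defs.v *)
From HB Require Import structures.
From mathcomp Require Import all_boot all_order all_algebra.
From mathcomp Require Import all_classical all_reals all_analysis.

Set Implicit Arguments.
Unset Strict Implicit.
Unset Printing Implicit Defensive.

Import Order.TTheory GRing.Theory Num.Theory.
Import numFieldNormedType.Exports.

Local Open Scope classical_set_scope.
Local Open Scope ring_scope.

Definition successors (R : realType) (n : nat) (AA : set 'M[R]_n)
    (W : set 'cV[R]_n) (x : 'cV[R]_n) : set 'cV[R]_n :=
  [set y | exists A w, [/\ AA A, W w & y = A *m x + w]].

Definition robust_positively_invariant (R : realType) (n : nat)
    (AA : set 'M[R]_n) (W X S : set 'cV[R]_n) : Prop :=
  forall x, S x -> successors AA W x `<=` S /\ X x.

Definition maximal_rpi (R : realType) (n : nat) (AA : set 'M[R]_n)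
    (W X M : set 'cV[R]_n) : Prop :=
  robust_positively_invariant AA W X M /\
  forall S, robust_positively_invariant AA W X S -> S `<=` M.

Lemma maximal_rpi_exists_unique (R : realType) (n : nat) (AA : set 'M[R]_n)
    (W X : set 'cV[R]_n) : exists! M, maximal_rpi AA W X M.
Proof.
exists (\bigcup_(S in robust_positively_invariant AA W X) S); split.
  split=> [x [S rS Sx]|S rS x Sx]; last by exists S.
  have [FS Xx] := rS _ Sx.
  by split=> // y /FS Sy; exists S.
move=> M [rM maxM]; apply/seteqP; split=> [x [S rS Sx]|x Mx].
  exact: maxM Sx.
by exists M.
Qed.

Fixpoint trajectory (R : realType) (n : nat) (A : nat -> 'M[R]_n)
    (w : nat -> 'cV[R]_n) (x0 : 'cV[R]_n) (k : nat) : 'cV[R]_n :=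
  if k is j.+1 then A j *m trajectory A w x0 j + w j else x0.

(* The finite sequences A_0, ..., A_{k-1} and w_0, ..., w_{k-1} are encoded as
   functions on nat constrained only at the indices j < k; the later values
   do not influence trajectory A w x0 k. *)
Definition Y_seq (R : realType) (n : nat) (AA : set 'M[R]_n)
    (W X : set 'cV[R]_n) (k : nat) : set 'cV[R]_n :=
  if k is 0%N then X else
  [set x0 | forall (A : nat -> 'M[R]_n) (w : nat -> 'cV[R]_n),
     (forall j, (j < k)%N -> AA (A j) /\ W (w j)) -> X (trajectory A w x0 k)].

Definition one_step_backward (R : realType) (n : nat) (AA : set 'M[R]_n)
    (W S : set 'cV[R]_n) : set 'cV[R]_n :=
  [set x | forall A w, AA A -> W w -> S (A *m x + w)].

Inductive recursion := Standard | SelfRestricted | Incremental.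

Fixpoint X_seq (R : realType) (n : nat) (r : recursion) (AA : set 'M[R]_n)
    (W X : set 'cV[R]_n) (k : nat) : set 'cV[R]_n :=
  if k is j.+1 then
    let Xj := X_seq r AA W X j in
    match r with
    | Standard => one_step_backward AA W Xj `&` X
    | SelfRestricted => one_step_backward AA W Xj `&` Xj
    | Incremental => Xj `&` Y_seq AA W X j.+1
    end
  else X.

(* Main.v *)
Require Import Defs.
From HB Require Import structures.
From mathcomp Require Import all_boot all_order all_algebra.
From mathcomp Require Import all_classical all_reals all_analysis.

Import Order.TTheory GRing.Theory Num.Theory.
Import numFieldNormedType.Exports.

Local Open Scope classical_set_scope.
Local Open Scope ring_scope.

(** Write pre for the one-step backward operator: pre S collects the points
    all of whose successors lie in S, that is
    pre S = \bigcap_(A, w) (x |-> A x + w)^-1(S).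
    Everything rests on two facts.

    First, splitting off the initial step of a trajectory gives
    Y_(k+1) = pre Y_k ([Y_seqS]).  As pre commutes with intersections, an
    induction then shows that each of the three recursions produces
    X_k = Y_0 /\ ... /\ Y_k ([X_seqE]).  The X_k are therefore decreasing, with
    intersection \bigcap_k Y_k, and that set is the maximal robust positively
    invariant set: a robust positively invariant set S satisfies S <= X and
    S <= pre S, hence S <= Y_k for every k by monotonicity of pre
    ([rpi_sub_Y_seq]); conversely, if x lies in all Y_(k+1) = pre Y_k then the
    successors of x lie in all Y_k, so that \bigcap_k Y_k is itself robust
    positively invariant ([rpi_bigcap_Y_seq]).

    Second, a property of sets that is stable under pre and under binary
    intersection passes from X to every X_k and Y_k ([X_Y_seq_ind]).
    Closedness and convexity are stable under pre because pre S is an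
    intersection of preimages of S under continuous affine maps; symmetry is
    stable when W = -W because A (- x) + w = - (A x + (- w)). *)

(** * Backward steps and the sequences X_k and Y_k *)

Section Backward.
Context {R : realType} {n : nat}.
Variables (AA : set 'M[R]_n) (W X : set 'cV[R]_n).
Implicit Types (S T : set 'cV[R]_n) (r : recursion) (k : nat).

Local Notation pre := (one_step_backward AA W).

Lemma one_step_backwardE S :
  pre S = \bigcap_(A in AA) \bigcap_(w in W) [set x | S (A *m x + w)].
Proof.
apply/seteqP; split=> [x xS A AA_A w Ww|x xS A w AA_A Ww]; first exact: xS.
exact: xS AA_A _ Ww.
Qed.

Lemma one_step_backwardS S T : S `<=` T -> pre S `<=` pre T.
Proof. by move=> ST x xS A w AA_A Ww; apply/ST/xS. Qed.

Lemma trajectory_shift A w (x : 'cV[R]_n) k :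
  trajectory A w x k.+1 =
  trajectory (fun j => A j.+1) (fun j => w j.+1) (A 0%N *m x + w 0%N) k.
Proof.
by elim: k => [//|k IHk]; rewrite [LHS]/= -/(trajectory A w x k.+1) IHk.
Qed.

Lemma Y_seqP k x : Y_seq AA W X k x <->
  forall A w, (forall j, (j < k)%N -> AA (A j) /\ W (w j)) ->
    X (trajectory A w x k).
Proof.
case: k => //=; split=> [Xx A w _ //|Xx].
(* No constraint bears on the sequences here: any pair gives X x. *)
exact: (Xx (fun=> 0) (fun=> 0)).
Qed.

(** A trajectory of length k+1 from x is a first step from x to some
    successor y followed by a trajectory of length k from y. *)
Lemma Y_seqS k : Y_seq AA W X k.+1 = pre (Y_seq AA W X k).
Proof.
apply/seteqP; split=> x.
  move=> xY A0 w0 AA0 W0; apply/Y_seqP => A w Aw.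
  pose A' j := if j is i.+1 then A i else A0.
  pose w' j := if j is i.+1 then w i else w0.
  rewrite -(trajectory_shift A' w'); apply: xY => -[|j] //.
  exact: Aw.
move=> xY A w Aw; rewrite trajectory_shift.
have [AA0 W0] := Aw 0%N isT.
by have /Y_seqP := xY _ _ AA0 W0; apply=> j jk; apply: Aw.
Qed.

Lemma bigcap_Y_seqS k :
  \bigcap_(j in [set j | (j <= k.+1)%N]) Y_seq AA W X j =
  pre (\bigcap_(j in [set j | (j <= k)%N]) Y_seq AA W X j) `&` X.
Proof.
apply/seteqP; split=> [x xY|x [xY Xx] [|j] // jk].
  split; last exact: (xY 0%N).
  move=> A w AA_A Ww j /= jk.
  have : Y_seq AA W X j.+1 x by exact: xY.
  by rewrite Y_seqS; apply.
by rewrite Y_seqS => A w AA_A Ww; exact: xY AA_A Ww _ jk.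
Qed.

(** Since pre commutes with intersections, pre turns Y_0 /\ ... /\ Y_k into
    Y_1 /\ ... /\ Y_(k+1); the recursions differ only in which of the sets
    Y_0, ..., Y_k they intersect with this, or in adding Y_(k+1) alone. *)
Lemma X_seqE r k : X_seq r AA W X k =
  \bigcap_(j in [set j | (j <= k)%N]) Y_seq AA W X j.
Proof.
elim: k => [|k IHk].
  apply/seteqP; split=> [x Xx [|j] //|x xY].
  exact: (xY 0%N).
case: r IHk => IHk; rewrite [LHS]/= -/(Y_seq AA W X k.+1) IHk.
- by rewrite bigcap_Y_seqS.
- apply/seteqP; split=> x xY.
    by rewrite bigcap_Y_seqS; case: xY => ? xX; split=> //; exact: (xX 0%N).
  split; first by move: xY; rewrite bigcap_Y_seqS => -[].
  by move=> j /= jk; apply: xY; exact: leqW.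
- apply/seteqP; split=> [x [xY xYk] j /=|x xY].
    by rewrite leq_eqVlt => /predU1P[-> //|]; exact: xY.
  by split=> [j /= jk|]; apply: xY => //=; exact: leqW.
Qed.

Lemma X_seqS_sub r k : X_seq r AA W X k.+1 `<=` X_seq r AA W X k.
Proof. by rewrite !X_seqE => x xY j /= jk; apply: xY; exact: leqW. Qed.

Lemma bigcap_X_seqE r :
  \bigcap_(k in [set: nat]) X_seq r AA W X k =
  \bigcap_(k in [set: nat]) Y_seq AA W X k.
Proof.
apply/seteqP; split=> x xX k _; last by rewrite X_seqE => j _; apply: xX.
by have := xX k I; rewrite X_seqE; apply; exact: leqnn.
Qed.

Lemma rpiP S :
  robust_positively_invariant AA W X S <-> S `<=` pre S /\ S `<=` X.
Proof.
split=> [rS|[Spre SX] x Sx].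
  split=> x /rS[FS Xx] // A w AA_A Ww; apply: FS; by exists A, w.
by split=> [_ [A [w [AA_A Ww ->]]]|]; [apply: Spre|apply: SX].
Qed.

Lemma rpi_sub_Y_seq S k :
  robust_positively_invariant AA W X S -> S `<=` Y_seq AA W X k.
Proof.
move=> /rpiP[Spre SX]; elim: k => [//|k IHk]; rewrite Y_seqS.
by move=> x /Spre; exact: one_step_backwardS.
Qed.

Lemma rpi_bigcap_Y_seq :
  robust_positively_invariant AA W X (\bigcap_(k in [set: nat]) Y_seq AA W X k).
Proof.
apply/rpiP; split=> x xY; last exact: (xY 0%N).
move=> A w AA_A Ww k _; have : Y_seq AA W X k.+1 x by exact: xY.
by rewrite Y_seqS; apply.
Qed.

Lemma X_Y_seq_ind (P : set 'cV[R]_n -> Prop) :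
  (forall S, P S -> P (pre S)) ->
  (forall S T, P S -> P T -> P (S `&` T)) ->
  P X -> forall r k, P (X_seq r AA W X k) /\ P (Y_seq AA W X k).
Proof.
move=> Ppre PI PX r.
have PY k : P (Y_seq AA W X k).
  by elim: k => [//|k IHk]; rewrite Y_seqS; exact: Ppre.
move=> k; split=> //; elim: k => [//|k IHk].
by case: r IHk => IHk; apply: PI => //; exact: Ppre.
Qed.

End Backward.

(** * Properties stable under backward steps *)

(** The neighbourhoods of a matrix are generated by boxes, that is by one
    neighbourhood for each of its finitely many entries. *)
Lemma continuous_mx (T U : topologicalType) (m p : nat) (f : T -> 'M[U]_(m, p)) :
  (forall i j, continuous (fun x => f x i j)) -> continuous f.
Proof.
move=> fc x B [P fxP PB]; apply: filterS (fun y => PB (f y)) _ => /=.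
apply: filter_forall => i; apply: filter_forall => j.
exact: fc (fxP i j).
Qed.

Section Stability.
Context {R : realType} {n : nat}.
Implicit Types (AA : set 'M[R]_n) (W S T : set 'cV[R]_n).

Lemma continuous_affine (A : 'M[R]_n) (w : 'cV[R]_n) :
  continuous (fun x : 'cV[R]_n => A *m x + w).
Proof.
apply: continuous_mx => i j.
rewrite (_ : (fun x => _) = (\sum_k (fun x : 'cV[R]_n => A i k * x k j)) +
    cst (w i j)); last first.
  by apply/funext => x; rewrite !mxE fctE fct_sumE.
move=> x; apply: continuousD; last exact: cst_continuous.
elim/big_ind: _ => [|f g fc gc|k _]; first exact: cst_continuous.
  exact: continuousD.
apply: continuousM; first exact: cst_continuous.
exact: coord_continuous.
Qed.

Lemma closed_one_step_backward AA W S :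
  closed S -> closed (one_step_backward AA W S).
Proof.
move=> cS; rewrite one_step_backwardE.
apply: closed_bigI => A _; apply: closed_bigI => w _.
by apply: (preimage_closed _ cS) => x _; exact: continuous_affine.
Qed.

Lemma convex_setI S T : convex_set S -> convex_set T -> convex_set (S `&` T).
Proof.
move=> cS cT x y l; rewrite !in_setI => /andP[xS xT] /andP[yS yT].
by rewrite cS ?cT.
Qed.

Lemma affine_conv (A : 'M[R]_n) (w : 'cV[R]_n) (l : {i01 R})
    (x y : convex_lmodType 'cV[R]_n) :
  A *m (conv l x y : 'cV[R]_n) + w =
  conv l (A *m x + w : convex_lmodType _) (A *m y + w).
Proof.
rewrite /conv /= mulmxDr -!scalemxAr !scalerDr addrACA -scalerDl.
by rewrite unstable.add_onemK scale1r.
Qed.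

Lemma convex_one_step_backward AA W S :
  convex_set S -> convex_set (one_step_backward AA W S).
Proof.
move=> cS x y l; rewrite !inE => xS yS A w AA_A Ww.
rewrite affine_conv; apply: set_mem.
by apply: cS; apply: mem_set; [apply: xS|apply: yS].
Qed.

Lemma symmetric_setP S : S = [set - x | x in S] <-> forall x, S x -> S (- x).
Proof.
split=> [SE x|SN].
  by rewrite {1}SE => -[y Sy <-]; rewrite opprK.
apply/seteqP; split=> [x Sx|_ [x Sx <-]]; last exact: SN.
by exists (- x); rewrite ?opprK //; exact: SN.
Qed.

Lemma symmetric_setI S T : S = [set - x | x in S] -> T = [set - x | x in T] ->
  S `&` T = [set - x | x in S `&` T].
Proof.
move=> /symmetric_setP SN /symmetric_setP TN; apply/symmetric_setP.
by move=> x [/SN ? /TN].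
Qed.

Lemma symmetric_one_step_backward AA W S :
  W = [set - w | w in W] -> S = [set - x | x in S] ->
  one_step_backward AA W S = [set - x | x in one_step_backward AA W S].
Proof.
move=> /symmetric_setP WN /symmetric_setP SN; apply/symmetric_setP.
move=> x xS A w AA_A Ww.
rewrite (_ : _ + w = - (A *m x - w)); last by rewrite mulmxN opprB addrC.
by apply/SN/xS => //; exact: WN.
Qed.

End Stability.

(** * Structure of the sequences and of their limit *)

Theorem corollary5 (R : realType) (n : nat) (AA : set 'M[R]_n)
    (W X M : set 'cV[R]_n) (r : recursion)
    (hA : AA !=set0) (hW : W !=set0) (hM : maximal_rpi AA W X M) :
  [/\ (forall k : nat, M `<=` X_seq r AA W X k.+1 /\
         X_seq r AA W X k.+1 `<=` X_seq r AA W X k),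
      M = \bigcap_(k in [set: nat]) X_seq r AA W X k,
      (closed X -> forall k : nat,
         closed (X_seq r AA W X k) /\ closed (Y_seq AA W X k)),
      (convex_set X -> forall k : nat,
         convex_set (X_seq r AA W X k) /\ convex_set (Y_seq AA W X k)) &
      (X = [set - x | x in X] -> W = [set - w | w in W] -> forall k : nat,
         X_seq r AA W X k = [set - x | x in X_seq r AA W X k] /\
         Y_seq AA W X k = [set - x | x in Y_seq AA W X k])].
Proof.
have [rM maxM] := hM.
have ME : M = \bigcap_(k in [set: nat]) X_seq r AA W X k.
  rewrite bigcap_X_seqE; apply/seteqP; split=> [x Mx k _|].
    exact: rpi_sub_Y_seq rM _ Mx.
  exact/maxM/rpi_bigcap_Y_seq.
split=> //.
- move=> k; split; last exact: X_seqS_sub.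
  by rewrite ME; exact: bigcap_inf.
- move=> cX k; apply: (X_Y_seq_ind _ _ _ closed) => //.
    exact: closed_one_step_backward.
  exact: closedI.
- move=> cX k; apply: (X_Y_seq_ind _ _ _ (@convex_set R 'cV[R]_n)) => //.
    exact: convex_one_step_backward.
  exact: convex_setI.
- move=> sX sW k.
  apply: (X_Y_seq_ind _ _ _ (fun S => S = [set - x | x in S])) => //.
    by move=> S; exact: symmetric_one_step_backward.
  exact: symmetric_setI.
Qed.
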